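(* Let $n\in\mathbb N\cup\{\infty\}$, let $k^i\ge0$ for $1\le i\le n$, and let $q=(q^i)_{1\le i\le n}$ have independent components, each exponentially distributed with rate 1. Let $t\ge1$, let $s_{<t}\in\mathbb R^n$ be arbitrary, let $s_t\in[0,1]^n$, $s_{1:t}=s_{<t}+s_t$, and $\eta_t>0$. Let $\ell_t$ and $r_t$ be the expected losses at time $t$ of FPL (Follow the Perturbed Leader) and IFPL (infeasible FPL), respectively, defined in the context. Then $$\ell_t\le e^{\eta_t}r_t .$$ Consequently, for any $T\ge1$, loss vectors $s_1,\dots,s_T\in[0,1]^n$ (with $s_{<t}=s_1+\dots+s_{t-1}$) and $\eta_1,\dots,\eta_T>0$, $$\sum_{t=1}^T\ell_t-\sum_{t=1}^Tr_t\le\sum_{t=1}^T\eta_t\ell_t .$$ Furthermore, if $\eta_t\le1$, then also $\ell_t\le(1+\eta_t+\eta_t^2)r_t\le(1+2\eta_t)r_t$.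
   Context: Experts are indexed by $i$ with $1\le i\le n$ (all $i\in\mathbb N$ if $n=\infty$); $s_t^i$ is the loss of expert $i$ at time $t$. Exponentially distributed with rate 1 means density $e^{-x}$, $x\ge 0$. Define the random indices $$I_t=\arg\min_i\Big\{s_{<t}^i+\frac{k^i-q^i}{\eta_t}\Big\},\qquad J_t=\arg\min_i\Big\{s_{1:t}^i+\frac{k^i-q^i}{\eta_t}\Big\}$$ (choices of FPL and of IFPL, the latter knowing $s_t$), and $\ell_t=E[s_t^{I_t}]$, $r_t=E[s_t^{J_t}]$. If $n=\infty$ it is assumed that these minima are attained almost surely (this is automatic when $s_{<t}\ge0$ and $\sum_ie^{-k^i}\le1$); ties have probability zero. *)

(* Defs.v *)
(* Library world: MathComp and MathComp-Analysis. *)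
From HB Require Import structures.
From mathcomp Require Import all_boot all_order all_algebra.
From mathcomp Require Import finmap.
From mathcomp Require Import all_classical all_reals all_analysis.

Set Implicit Arguments.
Unset Strict Implicit.
Unset Printing Implicit Defensive.

Import Order.TTheory GRing.Theory Num.Theory.

Local Open Scope classical_set_scope.
Local Open Scope ring_scope.

(* [n = Some m] stands for finitely many experts 1, ..., m, and [n = None] for
   n = oo, i.e. all the positive integers. *)
Definition expert (n : option nat) : Type :=
  {i : nat | (0 < i)%N && (if n is Some m then (i <= m)%N else true)}.

Section argmin.
Context {R : realType} {n : option nat}.
Implicit Type f : expert n -> R.

Definition minimizers f : set (expert n) := [set i | forall j, f i <= f j].

(* Ties are broken in favour of the smallest index; [None] if the minimum is
   not attained. *)
Definition argmin f : option (expert n) :=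
  xget None [set Some i | i in
    [set i | minimizers f i /\
             forall j, minimizers f j -> (val i <= val j)%N]].

End argmin.

Section probability.
Context {R : realType} {d : measure_display} {Omega : measurableType d}.
Context (P : probability Omega R).

Definition mutually_independent (I : choiceType) (X : I -> {RV P >-> R}) : Prop :=
  forall (F : {fset I}) (A : I -> set R), (forall i, measurable (A i)) ->
    P (\bigcap_(i in [set` F]) X i @^-1` A i) =
    (\prod_(i <- F) P (X i @^-1` A i))%E.

Definition exponentially_distributed (rate : R) (X : {RV P >-> R}) : Prop :=
  forall A : set R, measurable A -> distribution P X A = exponential_prob rate A.

End probability.

Section perturbed_leader.
Context {R : realType} {d : measure_display} {Omega : measurableType d}.
Context (P : probability Omega R) {n : option nat}.
Context (k : expert n -> R) (q : expert n -> {RV P >-> R}).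

Definition perturbed (s : expert n -> R) (eta : R) (w : Omega) :
    expert n -> R :=
  fun i => s i + (k i - q i w) / eta.

Definition perturbed_min_attained (s : expert n -> R) (eta : R) : Prop :=
  {ae P, forall w, minimizers (perturbed s eta w) !=set0}.

(* The value 0 taken when the minimum is not attained is immaterial: this
   happens with probability zero, unless there is no expert at all. *)
Definition leader_loss (s st : expert n -> R) (eta : R) (w : Omega) : R :=
  if argmin (perturbed s eta w) is Some i then st i else 0.

(* [slt] is the cumulative loss before time t, [st] the loss at time t. *)
Definition FPL_loss (slt st : expert n -> R) (eta : R) : \bar R :=
  'E_P[leader_loss slt st eta].

Definition IFPL_loss (slt st : expert n -> R) (eta : R) : \bar R :=
  'E_P[leader_loss (slt \+ st) st eta].

End perturbed_leader.

Definition past_loss {R : realType} {n : option nat}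
    (s : nat -> expert n -> R) (t : nat) : expert n -> R :=
  fun i => \sum_(1 <= u < t) s u i.

(* Main.v *)
Require Import Defs.
From HB Require Import structures.
From mathcomp Require Import all_boot all_order all_algebra.
From mathcomp Require Import finmap.
From mathcomp Require Import all_classical all_reals all_analysis.
From mathcomp Require Import measurable_realfun ring lra.

Set Implicit Arguments.
Unset Strict Implicit.
Unset Printing Implicit Defensive.

Import Order.TTheory GRing.Theory Num.Theory.
Import numFieldNormedType.Exports.

Local Open Scope classical_set_scope.
Local Open Scope ring_scope.

(* If i leads for the perturbation q, then i still leads after the losses in
   [0, 1] at time t are added and q i is raised by eta. So P(I = i) is at most
   the probability that J = i for the raised perturbation. By independence and
   memorylessness, raising q i by eta amounts to conditioning on q i >= eta, an
   event of probability exp(- eta); hence P(I = i) <= exp(eta) * P(J = i), and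
   summing s_t^i times this inequality over i gives l <= exp(eta) * r. *)

(** * Real analysis: a bound on exp, translations, the exponential law *)

Section real_facts.
Context {R : realType}.
Local Notation mu := (@lebesgue_measure R).

(** The function [(1 + y + y ^+ 2) * expR (- y)] equals 1 at 0, and its derivative
    [y * (1 - y) * expR (- y)] is nonnegative on [0, 1]. *)
Lemma expR_le_quadratic (x : R) : 0 <= x -> x <= 1 ->
  expR x <= 1 + x + x ^+ 2.
Proof.
move=> x0 x1; pose f (y : R) := (1 + y + y ^+ 2) * expR (- y).
have df (y : R) : is_derive y (1 : R) f (y * (1 - y) * expR (- y)).
  rewrite /f; apply: is_derive_eq; rewrite /GRing.scale/=.
  ring.
have : f 0 <= f x.
  apply: (@ger0_derive1_ndecr R f 0 1) => // [y|].
    rewrite in_itv/= => /andP[y0 y1].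
    by rewrite derive1E derive_val !mulr_ge0 ?expR_ge0//; lra.
  apply: derivable_within_continuous => y _; exact: ex_derive.
rewrite /f oppr0 expR0 expr0n/= !addr0 mulr1 expRN.
by rewrite ler_pdivlMr ?expR_gt0// mul1r.
Qed.

(** Lebesgue measure is determined by its values on half-open intervals, and a translation preserves
    their lengths. *)
Lemma lebesgue_measureD (a : R) (A : set R) : measurable A ->
  pushforward mu (fun x : measurableTypeR R => x + a : measurableTypeR R) A
  = mu A.
Proof.
have mD : measurable_fun [set: measurableTypeR R]
    (fun x : measurableTypeR R => x + a : measurableTypeR R).
  exact: measurable_funD.
pose mix := isMeasurableFun.Build _ _ _ _ _ mD.
pose phi : {mfun measurableTypeR R >-> measurableTypeR R} :=
  HB.pack (fun x : measurableTypeR R => x + a : measurableTypeR R) mix.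
move=> mA; apply/esym.
apply: (@lebesgue_measure_unique _ (pushforward mu phi)) => //= _ [[x y]] _ <-.
rewrite /pushforward.
rewrite (_ : _ @^-1` _ = `](x - a), (y - a)]%classic); last first.
  by apply/seteqP; split=> z /=; rewrite !in_itv/= ltrBlDr lerBrDr.
rewrite !lebesgue_measure_itv/= !lte_fin ltrD2r.
by case: ifP => // _; rewrite -!EFinB; congr EFin; ring.
Qed.

(** Memorylessness in one dimension: for [y >= a] the density at [y] is [expR (- rate * a)] times
    the density at [y - a], and translation invariance of [mu] allows the substitution
    [y = x + a]. *)
Lemma exponential_prob_ge (rate a : R) (A : set R) : 0 <= rate -> 0 <= a ->
  measurable A ->
  exponential_prob rate (A `&` `[a, +oo[) =
  ((expR (- rate * a))%:E * exponential_prob rate [set x | A (x + a)%R])%E.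
Proof.
move=> rate0 a0 mA.
have mf : measurable_fun setT (EFin \o exponential_pdf rate).
  by apply/measurable_EFinP; exact: measurable_exponential_pdf.
(* The density vanishes on negative reals, so [g] is 0 below [a] and absorbs the restriction to [[a,
   +oo[]. *)
pose g y := ((expR (- rate * a))%:E * (exponential_pdf rate (y - a)%R)%:E)%E.
have mD : measurable_fun [set: measurableTypeR R]
    (fun x : measurableTypeR R => x + a : measurableTypeR R).
  exact: measurable_funD.
have mg : measurable_fun setT g.
  apply: measurable_funeM; apply: (measurableT_comp mf).
  exact: measurable_funB.
rewrite /exponential_prob integral_mkcondr.
transitivity (\int[mu]_(x in A) g x)%E.
  apply: eq_integral => y _; rewrite /g patchE mem_setE in_itv/= andbT.
  case: leP => ay; last by rewrite lt0_exponential_pdf ?subr_lt0// mule0.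
  rewrite !exponential_pdfE ?subr_ge0 ?(le_trans a0)// -EFinM; congr EFin.
  by rewrite mulrCA -expRD; congr (_ * expR _); ring.
transitivity (\int[pushforward mu
    (fun x : measurableTypeR R => (x + a)%R : measurableTypeR R)]_(x in A)
    g x)%E.
  by apply: eq_measure_integral => //= B mB BA; exact/esym/lebesgue_measureD.
rewrite ge0_integral_pushforward//; last 2 first.
- exact: measurable_funTS.
- by move=> y _; rewrite /g mule_ge0 ?lee_fin ?expR_ge0 ?exponential_pdf_ge0.
have mA' : measurable [set x | A (x + a)].
  by rewrite -[X in measurable X]setTI; exact: mD.
rewrite -ge0_integralZl//; last 2 first.
- exact: measurable_funTS.
- by move=> x _; rewrite lee_fin exponential_pdf_ge0.
by apply: eq_integral => x _; rewrite /g /= addrK.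
Qed.

End real_facts.

(** * The product sigma-algebra on families of reals *)

Section product_of_lines.
Context {R : realType} {I : choiceType}.

(** Generators of the product sigma-algebra. The sides form a family over all of [I], trivial off
    the finite set [F], so that two cylinders intersect side by side. *)
Definition cylinders : set (set (I -> R)) :=
  [set E | exists (F : {fset I}) (A : I -> set R),
    [/\ forall i, measurable (A i), forall i, i \notin F -> A i = setT &
        E = [set f | forall i, A i (f i)]]].

Local Notation lines := (g_sigma_algebraType cylinders).

Lemma setI_closed_cylinders : setI_closed cylinders.
Proof.
move=> _ _ [F [A [mA AT ->]]] [G [B [mB BT ->]]].
exists (F `|` G)%fset, (fun i => A i `&` B i); split.
- by move=> i; exact: measurableI.
- by move=> i; rewrite in_fsetU negb_or => /andP[/AT -> /BT ->]; rewrite setTI.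
- apply/seteqP; split=> f /=; first by case=> fA fB i.
  by move=> fAB; split=> i; have [] := fAB i.
Qed.

Lemma cylinders_setT : cylinders setT.
Proof.
exists fset0, (fun=> setT); split => //.
by apply/seteqP; split.
Qed.

Lemma measurable_coordinate (i : I) :
  measurable_fun [set: lines] (fun f : lines => f i).
Proof.
move=> _ B mB; rewrite setTI; apply: sub_sigma_algebra.
exists [fset i]%fset, (fun j => if j == i then B else setT); split.
- by move=> j; case: ifP.
- by move=> j; rewrite in_fset1 => /negPf ->.
- apply/seteqP; split=> f /= fB; last by have := fB i; rewrite eqxx.
  by move=> j; case: eqP => [->|].
Qed.

Lemma cylinder_preimage (T : Type) (X : I -> T -> R) (F : {fset I})
    (A : I -> set R) : (forall i, i \notin F -> A i = setT) ->
  [set w | forall i, A i (X i w)] = \bigcap_(i in [set` F]) X i @^-1` A i.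
Proof.
move=> AT; apply/seteqP; split=> w /= wA; first by move=> i _; exact: wA.
by move=> i; have [iF|/AT ->//] := boolP (i \in F); exact: wA.
Qed.

Lemma measurable_to_lines d (T : measurableType d) (X : I -> T -> R) :
  (forall i, measurable_fun setT (X i)) ->
  measurable_fun setT (fun w => (X ^~ w) : lines).
Proof.
move=> mX; apply: (@measurability _ _ T lines setT _ cylinders) => //.
move=> _ [_ [F [A [mA AT ->]] <-]]; rewrite setTI.
rewrite [X in measurable X](cylinder_preimage X AT).
apply: fin_bigcap_measurable => // i _.
by rewrite -[X in measurable X]setTI; exact: mX.
Qed.

End product_of_lines.
Notation lines R I := (g_sigma_algebraType (@cylinders R I)).

(** * Memorylessness for one coordinate of an independent family *)

Section memorylessness.
Context {R : realType} {d : measure_display} {Omega : measurableType d}.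
Context (P : probability Omega R) {I : choiceType} (X : I -> {RV P >-> R}).
Hypothesis X_indep : mutually_independent X.

Definition shifted (i : I) (a : R) (w : Omega) : I -> R :=
  fun j => X j w + a *+ (j == i).

(** Isolates the factor of coordinate [i], so that cylinders differing only there can be compared.
    If [i] is not in [F], then [A i] is [setT] and [i] may be added to [F]. *)
Lemma probability_cylinder (i : I) (F : {fset I}) (A : I -> set R) :
  (forall j, measurable (A j)) -> (forall j, j \notin F -> A j = setT) ->
  P [set w | forall j, A j (X j w)] =
  (P (X i @^-1` A i) * \prod_(j <- (F `\ i)%fset) P (X j @^-1` A j))%E.
Proof.
move=> mA AT.
have AT' j : j \notin (i |` F)%fset -> A j = setT.
  by rewrite in_fset1U negb_or => /andP[_ /AT].
rewrite (cylinder_preimage _ AT') X_indep// (big_fsetD1 i) ?in_fset1U ?eqxx//=.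
suff -> : ((i |` F) `\ i = F `\ i)%fset by [].
by apply/fsetP => j; rewrite !inE; case: eqP.
Qed.

(** Both sides are finite measures of [E], so it suffices that they agree on the cylinders, a
    generating family closed under intersection. There independence gives products that differ only
    in the factor of [i], where [exponential_prob_ge] applies. *)
Lemma probability_shifted (rate a : R) (i : I) (E : set (lines R I)) :
  0 <= rate -> 0 <= a -> exponentially_distributed rate (X i) -> measurable E ->
  P [set w | E (X ^~ w) /\ a <= X i w] =
  ((expR (- rate * a))%:E * P [set w | E (shifted i a w)])%E.
Proof.
move=> rate0 a0 Xi mE.
have mX : measurable_fun setT (fun w => (X ^~ w) : lines R I).
  exact: measurable_to_lines.
have mS : measurable_fun setT (fun w => shifted i a w : lines R I).
  by apply: measurable_to_lines => j; apply: measurable_funD.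
pose fX w : lines R I := X ^~ w.
pose fS w : lines R I := shifted i a w.
have mD : measurable (X i @^-1` `[a, +oo[).
  by rewrite -[X in measurable X]setTI; exact: measurable_funP.
pose c := NngNum (expR_ge0 (- rate * a)).
have -> : [set w | E (X ^~ w) /\ a <= X i w] =
    fX @^-1` E `&` X i @^-1` `[a, +oo[.
  by apply/seteqP; split=> w /=; rewrite in_itv/= andbT.
pose m1 : {measure set (lines R I) -> \bar R} := pushforward (mrestr P mD) fX.
pose m2 : {measure set (lines R I) -> \bar R} := mscale c (pushforward P fS).
rewrite -[LHS]/(m1 mX E) -[RHS]/(m2 mS E).
apply: (@measure_unique _ R (lines R I) cylinders (fun=> setT) erefl
  setI_closed_cylinders (fun=> cylinders_setT) _ (m1 mX) (m2 mS)) => //.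
- by rewrite bigcup_const//; exists 0%N.
- move=> _ [F [A [mA AT ->]]].
  rewrite /m1 /m2 /pushforward /mrestr /mscale /=.
  (* [A1] moves the condition [a <= X i w] into side [i]; [A2] moves the shift by [a] into side [i].
     All other sides agree. *)
  pose A1 j := if j == i then A i `&` `[a, +oo[ else A j.
  pose A2 j := if j == i then [set x | A i (x + a)] else A j.
  have mA2 : measurable [set x | A i (x + a)].
    rewrite -[X in measurable X]setTI.
    have mDa : measurable_fun [set: R] (fun x => x + a).
      exact: measurable_funD.
    exact: mDa.
  have mA1 : measurable (A i `&` `[a, +oo[) by exact: measurableI.
  have AT1 j : j \notin (i |` F)%fset -> A1 j = setT.
    by rewrite in_fset1U negb_or /A1 => /andP[/negPf -> /AT].
  have AT2 j : j \notin (i |` F)%fset -> A2 j = setT.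
    by rewrite in_fset1U negb_or /A2 => /andP[/negPf -> /AT].
  rewrite [X in P X = _](_ : _ = [set w | forall j, A1 j (X j w)]); last first.
    apply/seteqP; split=> w /=.
      by move=> [Aw aw] j; rewrite /A1; case: eqP => [->|_]//; split.
    move=> Aw; split=> [j|]; last first.
      by have := Aw i; rewrite /A1 eqxx => -[].
    by have := Aw j; rewrite /A1; case: eqP => [->[]|].
  rewrite [X in _ = (_ * X)%E](_ : _ =
    P [set w | forall j, A2 j (X j w)]); last first.
    congr (P _).
    apply/seteqP; split=> w /= Aw j; have := Aw j; rewrite /A2 /fS /shifted;
      by case: eqP => [->|_]; rewrite ?mulr1n ?mulr0n ?addr0.
  rewrite (probability_cylinder i _ AT1); last first.
    by move=> j; rewrite /A1; case: eqP.
  rewrite (probability_cylinder i _ AT2); last first.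
    by move=> j; rewrite /A2; case: eqP.
  rewrite muleA; congr (_ * _)%E; last first.
    rewrite !big_seq; apply: eq_bigr => j; rewrite !inE => /andP[/negPf ji _].
    by rewrite /A1 /A2 ji.
  rewrite /A1 /A2 eqxx.
  have := Xi _ mA1; rewrite /distribution /pushforward => ->.
  have := Xi _ mA2; rewrite /distribution /pushforward => ->.
  exact: exponential_prob_ge.
(* Uniqueness of the measure also asks for finite mass on the covering set [setT]. *)
- move=> _; rewrite -[ltLHS]/(P (setT `&` X i @^-1` `[a, +oo[)) setTI.
  exact: le_lt_trans (probability_le1 _ mD) (ltry _).
Qed.

End memorylessness.

(** * The leader: characterization, stability and measurability *)

Section argmin.
Context {R : realType} {n : option nat}.
Implicit Types (f : expert n -> R) (i j : expert n).

(** Reduces the choice of the leader to one condition for each competitor [j], the form that both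
    the shift argument and measurability use. *)
Lemma argminP f i :
  argmin f = Some i <->
  forall j, f i <= f j /\ ((val j < val i)%N -> f i < f j).
Proof.
set S := [set j | minimizers f j /\
  forall l, minimizers f l -> (val j <= val l)%N].
have S_eq j l : S j -> S l -> j = l.
  move=> [mj jl] [ml lj]; apply/val_inj/eqP.
  by rewrite eqn_leq jl ?lj.
split=> [|fi].
  rewrite /argmin; case: xgetP => [_ _ [j [mj jmin] <-] [<-]|//] l.
  split=> [|lj]; first exact: mj.
  (* A tie with a smaller index [l] would make [l] a minimizer too, against the minimality of the
     index [j]. *)
  rewrite lt_neqAle mj andbT; apply: contraPN lj => /eqP fjl.
  by apply/negP; rewrite -leqNgt jmin// => h; rewrite -fjl.
have Si : S i.
  split=> [j|j mj]; first by case: (fi j).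
  rewrite leqNgt; apply/negP => /(fi j).2.
  by rewrite ltNge mj.
rewrite /argmin; case: xgetP => [_ -> [j Sj <-]|/(_ (Some i)) []].
  by rewrite (S_eq _ _ Sj Si).
by exists i.
Qed.

(* When expert i's perturbation grows by eta and losses in [0, 1] are added,
   the score of i does not increase relative to any other; in case of a new tie
   with j, the scores of i and j were already tied. *)
Lemma argmin_shifted (s st k x : expert n -> R) (eta : R) i :
  (forall j, 0 <= st j <= 1) -> 0 < eta ->
  argmin (fun j => s j + (k j - x j) / eta) = Some i ->
  argmin (fun j => (s \+ st) j + (k j - (x j + eta *+ (j == i))) / eta)
    = Some i.
Proof.
move=> st01 eta0 /argminP Hi; apply/argminP => j.
have [ij|ij] := eqVneq j i; first by rewrite ij eqxx ltnn; split.
have [/=] := Hi j; rewrite eqxx mulr1n mulr0n addr0.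
have -> : (k i - (x i + eta)) / eta = (k i - x i) / eta - 1.
  by field; rewrite gt_eqF.
have /andP[_ sti] := st01 i; have /andP[stj _] := st01 j.
move=> le1 lt1; split=> [|/lt1]; lra.
Qed.

(** By [argminP] the event is an intersection, over the countably many [j], of comparisons of two
    measurable scores. *)
Lemma measurable_argmin (s k : expert n -> R) (eta : R) i :
  measurable [set x : lines R (expert n) |
    argmin (fun j => s j + (k j - x j) / eta) = Some i].
Proof.
set score := fun (x : lines R (expert n)) j => s j + (k j - x j) / eta.
have mscore j : measurable_fun setT (score ^~ j).
  apply: measurable_funD => //; apply: measurable_funM => //.
  apply: measurable_funB => //; exact: measurable_coordinate.
rewrite (_ : mkset _ = ~` \bigcup_j ~` [set x | score x i <= score x j /\
    ((val j < val i)%N -> score x i < score x j)]); last first.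
  rewrite setC_bigcup; under eq_bigcapr do rewrite setCK.
  apply/seteqP; split=> x /= => [/argminP h j _|h]; first exact: h.
  by apply/argminP => j; exact: h.
apply: measurableC; apply: countable_bigcupT_measurable => [|j].
  exact: countableP.
apply: measurableC.
have mle l m : measurable [set x | score x l <= score x m].
  by rewrite -[X in measurable X]setTI; exact: measurable_fun_le.
have mlt : measurable [set x | score x i < score x j].
  rewrite (_ : mkset _ = ~` [set x | score x j <= score x i]).
    exact: measurableC.
  by apply/seteqP; split=> x /=; rewrite ltNge => /negP.
(* The strict comparison is a real constraint only for an index [j] below [i]; otherwise the
   implication is vacuous. *)
have [ji|ji] := boolP (val j < val i)%N.
  rewrite [X in measurable X](_ : _ = [set x | score x i <= score x j] `&`
    [set x | score x i < score x j]); first exact: measurableI.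
  by apply/seteqP; split=> x /= [h1 h2]; split=> //; exact: h2.
rewrite [X in measurable X](_ : _ = [set x | score x i <= score x j])//.
by apply/seteqP; split=> x /= => [[]//|h]; split.
Qed.

End argmin.

(** * Expectations as countable series, and monotonicity of the integral *)

Section countable_expectation.
Context {R : realType} {d : measure_display} {T : measurableType d}.
Context (P : probability T R) {I : countType}.

(** The variable is a series of nonnegative multiples of indicators of [J w = Some i], and integral
    and series may be exchanged. *)
Lemma expectation_countable_index (J : T -> option I) (c : I -> R) :
  (forall i, 0 <= c i) -> (forall i, measurable [set w | J w = Some i]) ->
  ('E_P[fun w => if J w is Some i then c i else 0%R] =
   \sum_(m <oo) if pickle_inv m is Some i
                then (c i)%:E * P [set w | J w = Some i] else 0)%E.
Proof.
move=> c0 mJ.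
(* [F m] is the contribution of the index with code [m], and 0 if [m] codes nothing. For each [w] at
   most one term is nonzero, and none if [J w] is [None]. *)
pose F m w : \bar R := if pickle_inv m is Some i
  then ((c i)%:E * (\1_[set w | J w = Some i] w)%:E)%E else 0%E.
have F0 m w : (0 <= F m w)%E.
  by rewrite /F; case: pickle_inv => // i; rewrite -EFinM lee_fin mulr_ge0.
rewrite unlock (_ : (fun w => _) = (fun w => \sum_(m <oo) F m w)%E); last first.
  apply/funext => w; case Jw: (J w) => [i|]; last first.
    rewrite eseries0// => m _ _; rewrite /F; case: pickle_inv => // i.
    by rewrite indicE memNset ?mule0//= Jw.
  rewrite (@nneseriesD1 _ _ (choice.pickle i))//= {1}/F pickleK_inv.
  rewrite indicE mem_set// mule1 eseries0 ?adde0// => m _ mi.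
  rewrite /F; case E: (pickle_inv m) => [j|//].
  rewrite indicE memNset ?mule0//= Jw => -[ij].
  by move: mi (@pickle_invK I m); rewrite E /= ij => /eqP mi /esym.
rewrite integral_nneseries//; last first.
  move=> m; rewrite /F; case: pickle_inv => [i|]; last exact: measurable_cst.
  apply: measurable_funeM; apply/measurable_EFinP; exact: measurable_indic.
apply: eq_eseriesr => m _; rewrite /F; case: pickle_inv => [i|]; last first.
  by rewrite integral0.
rewrite ge0_integralZl ?lee_fin//; first by rewrite integral_indic// setIT.
by apply/measurable_EFinP; exact: measurable_indic.
Qed.

End countable_expectation.

(** The integral of a nonnegative function is a supremum over simple functions below it, and those
    below [f] are also below [g]. *)
Lemma le_ge0_integralT {R : realType} d (T : measurableType d)
    (mu : {measure set T -> \bar R}) (f g : T -> \bar R) :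
  (forall x, 0 <= f x)%E -> (forall x, f x <= g x)%E ->
  (\int[mu]_x f x <= \int[mu]_x g x)%E.
Proof.
move=> f0 fg; have g0 x : (0 <= g x)%E by exact: le_trans (f0 x) (fg x).
rewrite !ge0_integralTE//; apply: ereal_sup_le => _ [h hf <-].
by exists h => // x; exact: le_trans (hf x) (fg x).
Qed.

(** * Comparison of the expected losses of FPL and IFPL *)

Section perturbed_leader.
Context (R : realType) (d : measure_display) (Omega : measurableType d).
Context (P : probability Omega R) (n : option nat).
Context (k : expert n -> R) (q : expert n -> {RV P >-> R}).
Hypothesis q_indep : mutually_independent q.
Hypothesis q_exp : forall i, exponentially_distributed 1 (q i).

Lemma measurable_leader (s : expert n -> R) (eta : R) i :
  measurable [set w | argmin (perturbed k q s eta w) = Some i].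
Proof.
have mq : measurable_fun setT (fun w => (q ^~ w) : lines R (expert n)).
  exact: measurable_to_lines.
have := mq measurableT _ (measurable_argmin s k eta i).
by rewrite setTI.
Qed.

(** Two inclusions around an equality: [argmin_shifted] passes to the shifted perturbation,
    [probability_shifted] turns the shift into the condition [eta <= q i w], and that condition is
    then dropped. *)
Lemma leader_prob_le (slt st : expert n -> R) (eta : R) i :
  (forall j, 0 <= st j <= 1) -> 0 < eta ->
  (P [set w | argmin (perturbed k q slt eta w) = Some i] <=
   (expR eta)%:E *
   P [set w | argmin (perturbed k q (slt \+ st)%R eta w) = Some i])%E.
Proof.
move=> st01 eta0.
pose E : set (lines R (expert n)) :=
  [set x | argmin (fun j => (slt \+ st) j + (k j - x j) / eta) = Some i].
have mE : measurable E by exact: measurable_argmin.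
have mS : measurable_fun setT (fun w => shifted q i eta w : lines R (expert n)).
  by apply: measurable_to_lines => j; apply: measurable_funD.
have mq : measurable_fun setT (fun w => (q ^~ w) : lines R (expert n)).
  exact: measurable_to_lines.
have mA : measurable [set w | E (shifted q i eta w)].
  by rewrite -[X in measurable X]setTI; exact: mS.
have mB : measurable [set w | E (q ^~ w) /\ eta <= q i w].
  rewrite (_ : mkset _ = [set w | E (q ^~ w)] `&` q i @^-1` `[eta, +oo[).
    by apply: measurableI; rewrite -[X in measurable X]setTI;
      [exact: mq|exact: measurable_funP].
  by apply/seteqP; split=> w /=; rewrite in_itv/= andbT.
apply: (@le_trans _ _ (P [set w | E (shifted q i eta w)])).
  apply: le_measure; rewrite ?inE//; first exact: measurable_leader.
  by move=> w; exact: argmin_shifted.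
have := probability_shifted q_indep ler01 (ltW eta0) (q_exp i) mE.
(* Multiplying by [expR eta] cancels [expR (- eta)] and solves the identity for the shifted
   probability. *)
rewrite mulN1r => /(congr1 (fun y => (expR eta)%:E * y)%E).
rewrite muleA -EFinM -expRD subrr expR0 mul1e => <-.
apply: lee_wpmul2l; first by rewrite lee_fin expR_ge0.
apply: le_measure; rewrite ?inE//; first exact: measurable_leader.
by move=> w [].
Qed.

Context (slt st : expert n -> R) (eta : R).
Hypothesis st01 : forall i, 0 <= st i <= 1.
Hypothesis eta0 : 0 < eta.

Local Notation l := (FPL_loss k q slt st eta).
Local Notation r := (IFPL_loss k q slt st eta).

Lemma expectation_leader_loss (s : expert n -> R) :
  ('E_P[leader_loss k q s st eta] = \sum_(m <oo) if pickle_inv m is Some i then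
    (st i)%:E * P [set w | argmin (perturbed k q s eta w) = Some i] else 0)%E.
Proof.
apply: expectation_countable_index => i; first by have /andP[] := st01 i.
exact: measurable_leader.
Qed.

Lemma leader_loss_ge0 (s : expert n -> R) w : 0 <= leader_loss k q s st eta w.
Proof.
by rewrite /leader_loss; case: argmin => // i; have /andP[] := st01 i.
Qed.

(** The loss lies in [0, 1] and [P] has mass at most 1. Finiteness lets the cumulative bound be
    argued in the reals. *)
Lemma expectation_leader_loss_fin (s : expert n -> R) :
  ('E_P[leader_loss k q s st eta])%E \is a fin_num.
Proof.
rewrite ge0_fin_numE; last first.
  by apply: expectation_ge0 => w; exact: leader_loss_ge0.
apply: (@le_lt_trans _ _ (\int[P]_w 1)%E); last first.
  rewrite integral_cst// mul1e.
  exact: le_lt_trans (probability_le1 P measurableT) (ltry _).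
rewrite unlock; apply: le_ge0_integralT => w; rewrite lee_fin.
  exact: leader_loss_ge0.
by rewrite /leader_loss; case: argmin => // i; have /andP[] := st01 i.
Qed.

(** Both sides expand into series over the possible leaders [i]; [leader_prob_le], weighted by
    [st i], compares them term by term. *)
Lemma FPL_le_expR_IFPL : (l <= (expR eta)%:E * r)%E.
Proof.
have st0 i : (0 <= (st i)%:E)%E by rewrite lee_fin; have /andP[] := st01 i.
rewrite /FPL_loss /IFPL_loss !expectation_leader_loss -nneseriesZl.
  apply: lee_nneseries => m.
    by case: pickle_inv => // i _ _; rewrite mule_ge0.
  case: pickle_inv => [i _|_]; last by rewrite mule0.
  rewrite muleCA; apply: lee_wpmul2l => //; exact: leader_prob_le.
by move=> m _; case: pickle_inv => // i; rewrite mule_ge0.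
Qed.

End perturbed_leader.

Theorem theorem4 (R : realType) (d : measure_display) (Omega : measurableType d)
    (P : probability Omega R) (n : option nat)
    (k : expert n -> R) (q : expert n -> {RV P >-> R})
    (k_ge0 : forall i, 0 <= k i)
    (q_indep : mutually_independent q)
    (q_exp : forall i, exponentially_distributed 1 (q i)) :
  (forall (slt st : expert n -> R) (eta : R),
     (forall i, 0 <= st i <= 1) ->
     0 < eta ->
     (n = None -> perturbed_min_attained k q slt eta /\
                  perturbed_min_attained k q (slt \+ st) eta) ->
     let l := FPL_loss k q slt st eta in
     let r := IFPL_loss k q slt st eta in
     (l <= (expR eta)%:E * r)%E /\
     (eta <= 1 ->
        (l <= (1 + eta + eta ^+ 2)%:E * r)%E /\
        ((1 + eta + eta ^+ 2)%:E * r <= (1 + 2 * eta)%:E * r)%E)) /\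
  (forall (T : nat) (s : nat -> expert n -> R) (eta : nat -> R),
     (1 <= T)%N ->
     (forall t, (1 <= t <= T)%N -> forall i, 0 <= s t i <= 1) ->
     (forall t, (1 <= t <= T)%N -> 0 < eta t) ->
     (n = None -> forall t, (1 <= t <= T)%N ->
        perturbed_min_attained k q (past_loss s t) (eta t) /\
        perturbed_min_attained k q (past_loss s t \+ s t) (eta t)) ->
     let l t := FPL_loss k q (past_loss s t) (s t) (eta t) in
     let r t := IFPL_loss k q (past_loss s t) (s t) (eta t) in
     (\sum_(1 <= t < T.+1) l t - \sum_(1 <= t < T.+1) r t
        <= \sum_(1 <= t < T.+1) (eta t)%:E * l t)%E).
Proof.
split=> [slt st eta st01 eta0 _ l r|T s eta _ s01 eta0 _].
  have r0 : (0 <= r)%E by apply: expectation_ge0 => w; exact: leader_loss_ge0.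
  have lr : (l <= (expR eta)%:E * r)%E by exact: FPL_le_expR_IFPL.
  split=> // eta1; split; last first.
    (* Here [eta ^+ 2 <= eta], because [eta] lies in [0, 1]. *)
    by apply: lee_wpmul2r => //; rewrite lee_fin; nra.
  apply: le_trans lr _; apply: lee_wpmul2r => //; rewrite lee_fin.
  exact: expR_le_quadratic (ltW eta0) eta1.
pose l t := FPL_loss k q (past_loss s t) (s t) (eta t).
pose r t := IFPL_loss k q (past_loss s t) (s t) (eta t).
change (\sum_(1 <= t < T.+1) l t - \sum_(1 <= t < T.+1) r t
  <= \sum_(1 <= t < T.+1) (eta t)%:E * l t)%E.
(* With every term finite, the difference of extended-real sums becomes a real one and can be
   bounded term by term. *)
have fin t : (1 <= t < T.+1)%N -> l t \is a fin_num /\ r t \is a fin_num.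
  by rewrite ltnS => tT; split; apply: expectation_leader_loss_fin; exact: s01.
have lE t : (1 <= t < T.+1)%N -> l t = (fine (l t))%:E.
  by move=> /fin[lf _]; rewrite fineK.
have rE t : (1 <= t < T.+1)%N -> r t = (fine (r t))%:E.
  by move=> /fin[_ rf]; rewrite fineK.
have elE t : (1 <= t < T.+1)%N ->
    ((eta t)%:E * l t)%E = (eta t * fine (l t))%:E.
  by move=> /lE ltE; rewrite EFinM -ltE.
rewrite (eq_big_nat _ _ elE) (eq_big_nat _ _ lE) (eq_big_nat _ _ rE).
rewrite !sumEFin -EFinB lee_fin -sumrB.
apply: ler_sum_nat => t tT.
have t1T : (1 <= t <= T)%N by rewrite -[(_ <= T)%N]ltnS.
have e0 := eta0 _ t1T.
have l0 : 0 <= fine (l t).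
  apply: fine_ge0; apply: expectation_ge0 => w.
  by apply: leader_loss_ge0; exact: s01.
have := FPL_le_expR_IFPL k q_indep q_exp (past_loss s t) (s01 _ t1T) e0.
rewrite -/(l t) -/(r t) lE// rE// -EFinM lee_fin => lr.
(* [1 - x <= expR (- x)] and [l <= expR x * r] give [(1 - x) * l <= r]. *)
have : expR (- eta t) * fine (l t) <= fine (r t).
  by rewrite expRN mulrC ler_pdivrMr ?expR_gt0// mulrC.
have := expR_ge1Dx (- eta t).
nra.
Qed.
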